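(* Let $P$ be a $\mu$-invariant Markov kernel on $(E,\mathscr{E})$ and $\Phi$ a $P$-non-expansive sieve, with some $f\in L^2_0(\mu)$ having $0<\Phi(f)<\infty$, such that $P^*P$ satisfies a $(\Phi,\beta)$-WPI for some $\beta$. Let $\beta^\star(\cdot;\Phi)$ be the optimal $\beta$ for $\Phi$ and let $\Phi^\star:=\Phi^\star_{\beta^\star(\cdot;\Phi)}$ be the optimal sieve for $\beta^\star(\cdot;\Phi)$. Then $$\beta^\star(\cdot;\Phi^\star)=\beta^\star(\cdot;\Phi)\quad\text{on }(0,\infty).$$
   Context: $(E,\mathscr{E})$ is a measurable space, $\mu$ a probability measure on it. $L^2_0(\mu)$ is the set of real $f\in L^2(\mu)$ with $\mu(f)=0$; $\mathcal{E}(T,f)=\langle(\mathrm{Id}-T)f,f\rangle$ in $L^2(\mu)$; $P^*$ is the adjoint of $P$. Sieve: $\Phi:L^2(\mu)\to[0,\infty]$ with $\Phi(cf)=c^2\Phi(f)$ for $c>0$ and $\|f-\mu(f)\|_2^2\le\mathfrak{a}\,\Phi(f-\mu(f))$ for all $f\in L^2(\mu)$, where $\mathfrak{a}:=\sup_{f\in L^2_0(\mu)\setminus\{0\}}\|f\|_2^2/\Phi(f)<\infty$. It is $P$-non-expansive if $\Phi(Pf)\le\Phi(f)$ for all $f\in L^2_0(\mu)$. $(\Phi,\beta)$-WPI for $P^*P$: $\beta:(0,\infty)\to[0,\infty)$ is decreasing (non-increasing), $\beta(s)\to0$ as $s\to\infty$, and $\|f\|_2^2\le s\,\mathcal{E}(P^*P,f)+\beta(s)\Phi(f)$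 for all $s>0$, $f\in L^2_0(\mu)$. Optimal $\beta$ for a functional $\Psi:L^2_0(\mu)\to[0,\infty]$: for $s>0$, $\beta^\star(s;\Psi)=\sup\{\|f\|_2^2-s\,\mathcal{E}(P^*P,f):f\in L^2_0(\mu),\ \Psi(f)\le1\}\vee0$. Optimal sieve for a bounded decreasing $\beta$: for $f\in L^2_0(\mu)$, $$\Phi_\beta(f)=\sup_{s>0}\frac{\|f\|_2^2-s\,\mathcal{E}(P^*P,f)}{\beta(s)},\qquad\Phi^\star_\beta(f)=\sup_{n\in\mathbb{N}_0}\Phi_\beta(P^nf),$$ where, if $\beta(s)=0$, the ratio $x/0$ is read as $+\infty$ if $x>0$ and $-\infty$ if $x\le0$. *)

(* Defs.v *)
(* Elements of L^2(mu) are represented by functions f : E -> R with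
   f \in Lfun mu 2 (measurable, finite L^2 norm); equality in L^2(mu) is
   equality mu-almost everywhere.  Functionals on L^2(mu) are functions
   (E -> R) -> \bar R; their values outside L^2(mu) are irrelevant. *)
From HB Require Import structures.
From mathcomp Require Import all_boot all_order all_algebra.
From mathcomp Require Import all_classical all_reals all_analysis.
Set Implicit Arguments.
Unset Strict Implicit.
Unset Printing Implicit Defensive.
Import Order.TTheory GRing.Theory Num.Theory.
Import numFieldNormedType.Exports.
Local Open Scope classical_set_scope.
Local Open Scope ring_scope.

Section WeakPoincare.
Context {d : measure_display} {E : measurableType d} {R : realType}.
Implicit Types (mu : probability E R) (P : R.-pker E ~> E).
Implicit Types (f g : E -> R) (T S : (E -> R) -> (E -> R)).
Implicit Types (Phi Psi : (E -> R) -> \bar R).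

Definition L2inner mu f g : R := \int[mu]_x (f x * g x).

Definition sqnorm mu f : R := L2inner mu f f.

Definition mean mu f : R := \int[mu]_x f x.

Definition centered mu f : E -> R := fun x => f x - mean mu f.

Definition L20 mu : set (E -> R) :=
  [set f | f \in Lfun mu 2%:E /\ mean mu f = 0].

(* The integral is 0 at the points x where f is not P x-integrable; for
   mu-invariant P and f in L^2(mu) these form a mu-null set. *)
Definition kernel_op P : (E -> R) -> (E -> R) := fun f x => \int[P x]_y f y.

Definition kernel_invariant mu P : Prop :=
  forall A, measurable A -> (\int[mu]_x P x A)%E = mu A.

Definition is_L2adjoint mu T S : Prop :=
  (forall g, g \in Lfun mu 2%:E -> S g \in Lfun mu 2%:E) /\
  (forall f g, f \in Lfun mu 2%:E -> g \in Lfun mu 2%:E ->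
     L2inner mu (T f) g = L2inner mu f (S g)).

(* A chosen adjoint of T; up to mu-a.e. equality it is unique on L^2(mu), and
   it exists for every bounded T.  The default value is never used then. *)
Definition L2adjoint mu T : (E -> R) -> (E -> R) :=
  xget (fun=> cst 0) [set S | is_L2adjoint mu T S].

Definition PstarP mu P : (E -> R) -> (E -> R) :=
  L2adjoint mu (kernel_op P) \o kernel_op P.

Definition dirichlet mu T f : R := L2inner mu (f \- T f) f.

(* Product of x >= 0 and y in [0, +oo] with the convention 0 * +oo = +oo in the
   second factor (the library has 0 * +oo = 0): an inequality with right-hand
   side x * Phi f is void when Phi f = +oo.  This is the convention matching
   [eratio] below: r <= b * y iff eratio r b <= y, for real b >= 0 and y >= 0. *)
Definition mul_top (x y : \bar R) : \bar R :=
  (if y == +oo then +oo else x * y)%E.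

(* sup of sqnorm f / Phi f over nonzero f in L^2_0(mu); the library's extended
   real division has r / 0 = +oo for r > 0 and r / +oo = 0. *)
Definition sieve_const mu Phi : \bar R :=
  ereal_sup [set ((sqnorm mu f)%:E / Phi f)%E
            | f in [set f | L20 mu f /\ ~ (f = cst 0 %[ae mu])]].

Record is_sieve mu Phi : Prop := Sieve {
  sieve_ae : forall f g, f \in Lfun mu 2%:E -> g \in Lfun mu 2%:E ->
    f = g %[ae mu] -> Phi f = Phi g;
  sieve_ge0 : forall f, f \in Lfun mu 2%:E -> (0 <= Phi f)%E;
  sieve_homo : forall (c : R) f, 0 < c -> f \in Lfun mu 2%:E ->
    Phi (fun x => c * f x) = ((c ^+ 2)%:E * Phi f)%E;
  sieve_const_fin : (sieve_const mu Phi < +oo)%E;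
  sieve_bound : forall f, f \in Lfun mu 2%:E ->
    ((sqnorm mu (centered mu f))%:E
       <= mul_top (sieve_const mu Phi) (Phi (centered mu f)))%E }.

Definition nonexpansive mu P Phi : Prop :=
  forall f, L20 mu f -> (Phi (kernel_op P f) <= Phi f)%E.

(* beta is only considered on (0, +oo). *)
Record WPI mu T Phi (beta : R -> R) : Prop := MkWPI {
  WPI_ge0 : forall s, 0 < s -> 0 <= beta s;
  WPI_decr : forall s t, 0 < s -> s <= t -> beta t <= beta s;
  WPI_cvg0 : beta s @[s --> +oo] --> 0;
  WPI_ineq : forall s f, 0 < s -> L20 mu f ->
    ((sqnorm mu f)%:E
       <= (s * dirichlet mu T f)%:E + mul_top (beta s)%:E (Phi f))%E }.

Definition beta_star mu P Psi (s : R) : \bar R :=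
  maxe (ereal_sup [set (sqnorm mu f - s * dirichlet mu (PstarP mu P) f)%:E
                  | f in [set f | L20 mu f /\ (Psi f <= 1)%E]])
       0%E.

Definition eratio (x : R) (b : \bar R) : \bar R :=
  (if b == 0 then (if (0 < x)%R then +oo else -oo) else x%:E / b)%E.

(* beta is extended-real valued so that it can be instantiated by beta_star. *)
Definition Phi_beta mu P (beta : R -> \bar R) f : \bar R :=
  ereal_sup [set eratio (sqnorm mu f - s * dirichlet mu (PstarP mu P) f) (beta s)
            | s in [set s : R | 0 < s]].

Definition Phi_star mu P (beta : R -> \bar R) f : \bar R :=
  ereal_sup (range (fun n : nat => Phi_beta mu P beta (iter n (kernel_op P) f))).

End WeakPoincare.

(* Main.v *)
(* Each inequality compares two constraint sets.  If Phi f <= 1, then, Phi being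
   P-non-expansive, every P^n f competes in the supremum defining beta_star, so
   Phi_star f <= 1.  Conversely Phi_star f <= 1 says, through n = 0, that
   sqnorm f - s * dirichlet f <= beta_star s.  The analytic input is that P
   preserves L^2_0(mu): Jensen's inequality together with invariance. *)
Require Import Defs.
From HB Require Import structures.
From mathcomp Require Import all_boot all_order all_algebra.
From mathcomp Require Import all_classical all_reals all_analysis.
From mathcomp Require Import measurable_realfun ring lra.
Import Order.TTheory GRing.Theory Num.Theory.
Import numFieldNormedType.Exports.
Local Open Scope classical_set_scope.
Local Open Scope ring_scope.

Section InvariantKernel.
Context {d : measure_display} {E : measurableType d} {R : realType}.
Variables (mu : probability E R) (P : R.-pker E ~> E).

Lemma measurable_kernel_integral (g : E -> \bar R) :
  (forall y, 0 <= g y)%E -> measurable_fun [set: E] g ->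
  measurable_fun [set: E] (fun x => \int[P x]_y g y)%E.
Proof.
move=> g0 mg; apply: measurable_fun_integral_kernel => //.
by move=> U mU; exact: measurable_kernel.
Qed.

Lemma measurable_kernel_op (f : E -> R) :
  measurable_fun [set: E] f -> measurable_fun [set: E] (kernel_op P f).
Proof.
move=> /measurable_EFinP mf.
apply: (@measurableT_comp _ _ _ _ _ _ fine) => //.
under eq_fun do rewrite integralE.
apply: emeasurable_funB; apply: measurable_kernel_integral => //.
  exact: measurable_funepos.
exact: measurable_funeneg.
Qed.

(** Jensen's inequality for the probability [P x]. An infinite right-hand side leaves nothing to
    prove; a finite one makes [f] integrable for [P x], so [kernel_op P f x] is its true mean. *)
Lemma sqr_kernel_op_le (f : E -> R) (x : E) : measurable_fun [set: E] f ->
  ((kernel_op P f x ^+ 2)%:E <= \int[P x]_y (f y ^+ 2)%:E)%E.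
Proof.
move=> mf; have Px1 : P x setT = 1%:E by exact: prob_kernel.
have mf2 : measurable_fun [set: E] (EFin \o (fun y => f y ^+ 2)).
  by apply/measurable_EFinP; exact: measurable_funX.
have [->|] := eqVneq (\int[P x]_y (f y ^+ 2)%:E)%E +oo%E; first exact: leey.
rewrite -ltey => f2_fin.
have if2 : (P x).-integrable setT (EFin \o (fun y => f y ^+ 2)).
  apply/integrableP; split=> //.
  by under eq_integral do rewrite gee0_abs ?lee_fin ?sqr_ge0//.
have ic (c : R) : (P x).-integrable setT (EFin \o cst c).
  apply/integrableP; split; first exact/measurable_EFinP.
  rewrite [ltLHS](_ : _ = `|c|%:E * P x setT)%E; last first.
    exact: (@integral_cst _ _ _ (P x) _ measurableT `|c|%:E).
  by rewrite Px1 mule1 ltry.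
have if1 : (P x).-integrable setT (EFin \o f).
  (* The bound [|f| <= 1 + f ^ 2] comes from [(|f| - 1) ^ 2 >= 0]. *)
  apply: (@le_integrable _ _ _ _ _ _ _ (EFin \o (fun y => 1 + f y ^+ 2))) => //.
  - exact/measurable_EFinP.
  - move=> y _ /=; rewrite lee_fin [leRHS]ger0_norm ?addr_ge0 ?sqr_ge0//.
    rewrite -(real_normK (num_real (f y))).
    by have := sqr_ge0 (`|f y| - 1); have := normr_ge0 (f y); nra.
  - exact: (integrableD measurableT (ic 1) if2).
set m := kernel_op P f x.
have mE : (m%:E = \int[P x]_y (f y)%:E)%E.
  by rewrite fineK//; exact: integrable_fin_num.
have im : (P x).-integrable setT (fun y => (m *+ 2)%:E * (f y)%:E)%E.
  exact: (integrableZl measurableT).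
(* As [m] is the mean of [f] under [P x], the function [2 m f - m ^ 2] has integral [m ^ 2]. *)
have -> : ((m ^+ 2)%:E =
    \int[P x]_y ((m *+ 2)%:E * (f y)%:E - (m ^+ 2)%:E))%E.
  rewrite integralB//; last exact: ic.
  rewrite integralZl// -mE [X in (_ - X)%E](_ : _ = (m ^+ 2)%:E); last first.
    rewrite [LHS](@integral_cst _ _ _ (P x) _ measurableT (m ^+ 2)%:E).
    by rewrite Px1 mule1.
  by rewrite -EFinM -EFinB; congr EFin; ring.
apply: le_integral => //.
  by apply: (integrableB measurableT im); exact: ic.
(* Jensen: integrate the tangent line 2 m f - m ^ 2 <= f ^ 2. *)
move=> y _; rewrite -EFinM -EFinB lee_fin -subr_ge0.
by have := sqr_ge0 (f y - m); nra.
Qed.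

Hypothesis P_inv : kernel_invariant mu P.

Lemma integral_kernel_invariant (g : E -> \bar R) :
  (forall y, 0 <= g y)%E -> measurable_fun [set: E] g ->
  (\int[mu]_x \int[P x]_y g y = \int[mu]_y g y)%E.
Proof.
move=> g0 mg.
(* [kernel_snd P] ignores its first argument, so this composition is x |-> mu P. *)
have := @integral_kcomp _ _ _ E E E R
  (kprobability (measurable_cst (mu : pprobability E R)))
  (kernel.kernel_snd P) point g g0 mg.
move=> /= <-; apply: eq_measure_integral => A mA _.
exact: P_inv.
Qed.

Lemma integrable_kernel_integral (g : E -> \bar R) :
  (forall y, 0 <= g y)%E -> mu.-integrable setT g ->
  mu.-integrable setT (fun x => \int[P x]_y g y)%E.
Proof.
move=> g0 /integrableP[mg gfin]; apply/integrableP; split.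
  exact: measurable_kernel_integral.
under eq_integral do rewrite gee0_abs ?integral_ge0//.
rewrite integral_kernel_invariant//.
by under eq_integral do rewrite -[g _]gee0_abs//.
Qed.

(** Invariance is applied to the positive and negative parts of [f] separately, both having finite
    integral. *)
Lemma mean_kernel_op (f : E -> R) : mu.-integrable setT (EFin \o f) ->
  mean mu (kernel_op P f) = mean mu f.
Proof.
move=> intf; congr fine.
have mf := measurable_int _ intf.
have ip : mu.-integrable setT (fun x => \int[P x]_y (EFin \o f)^\+ y)%E.
  by apply: integrable_kernel_integral => //; exact: integrable_funepos.
have ine : mu.-integrable setT (fun x => \int[P x]_y (EFin \o f)^\- y)%E.
  by apply: integrable_kernel_integral => //; exact: integrable_funeneg.
have iw := integrableB measurableT ip ine.
rewrite [RHS]integralE -(integral_kernel_invariant (EFin \o f)^\+%E)//.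
  rewrite -(integral_kernel_invariant (EFin \o f)^\-%E)//.
    rewrite -integralB//; apply: ae_eq_integral => //.
    - apply/measurable_EFinP/measurable_kernel_op.
      exact/measurable_EFinP.
    - exact: measurable_int iw.
    (* The [fine] inside [kernel_op] loses nothing where the difference of the two parts is finite,
       hence [mu]-almost everywhere. *)
    have := integrable_ae measurableT iw.
    apply: filterS => x /(_ I) wfin _.
    by rewrite /kernel_op /Rintegral integralE fineK.
  exact: measurable_funeneg.
exact: measurable_funepos.
Qed.

Lemma kernel_op_Lfun2 (f : E -> R) :
  f \in Lfun mu 2%:E -> kernel_op P f \in Lfun mu 2%:E.
Proof.
move=> f2; have mf : measurable_fun [set: E] f.
  by move: f2; rewrite inE => /andP[]; rewrite inE.
have mPf := measurable_kernel_op f mf.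
rewrite inE; apply/andP; split; rewrite inE//=.
rewrite /finite_norm unlock poweR_lty//=.
under eq_integral do rewrite powR_mulrn// real_normK ?num_real//.
have := integrable_lty measurableT (Lfun2_integrable_sqr f2).
apply: le_lt_trans.
(* Invariance turns the integral of [f ^ 2] into that of [x |-> \int[P x]_y f y ^ 2], which
   dominates [(kernel_op P f) ^ 2] pointwise. *)
rewrite -(integral_kernel_invariant (fun y => (f y ^+ 2)%:E))//.
- apply: ge0_le_integral => //.
  + by move=> x _; rewrite lee_fin sqr_ge0.
  + by apply/measurable_EFinP; exact: measurable_funX.
  + apply: measurable_kernel_integral => [y|]; first by rewrite lee_fin sqr_ge0.
    by apply/measurable_EFinP; exact: measurable_funX.
  + by move=> x _; exact: sqr_kernel_op_le.
- by move=> y; rewrite lee_fin sqr_ge0.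
- by apply/measurable_EFinP; exact: measurable_funX.
Qed.

Lemma kernel_op_L20 (f : E -> R) : L20 mu f -> L20 mu (kernel_op P f).
Proof.
move=> [f2 f0]; split; first exact: kernel_op_Lfun2.
rewrite mean_kernel_op//; apply/Lfun1_integrable.
by apply: Lfun_subset12 f2; rewrite ?fin_num_measure.
Qed.

End InvariantKernel.

(** The conventions fit the boundary cases: for [b = 0] the ratio is infinite with the sign deciding
    [x <= 0], and for [b = +oo] it is [0] and both sides hold. *)
Lemma eratio_le1 (R : realType) (x : R) (b : \bar R) : (0 <= b)%E ->
  (eratio x b <= 1)%E = (x%:E <= b)%E.
Proof.
rewrite /eratio; case: b => [b| |] //= b0; last first.
  by rewrite invey mule0 leey lee01.
rewrite eqe; case: eqVneq => [->|b_neq0].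
  by rewrite lee_fin; case: ltP => _; rewrite ?leNye ?leye_eq.
rewrite inver (negPf b_neq0) -EFinM !lee_fin ler_pdivrMr ?mul1r//.
by rewrite lt_neqAle eq_sym b_neq0.
Qed.

Theorem proposition35 (d : measure_display) (E : measurableType d)
    (R : realType) (mu : probability E R) (P : R.-pker E ~> E)
    (P_inv : kernel_invariant mu P)
    (Phi : (E -> R) -> \bar R)
    (Phi_sieve : is_sieve mu Phi)
    (Phi_nonexp : nonexpansive mu P Phi)
    (Phi_nontriv : exists f : E -> R,
       [/\ L20 mu f, (0 < Phi f)%E & (Phi f < +oo)%E])
    (P_WPI : exists beta : R -> R, WPI mu (PstarP mu P) Phi beta) :
  forall s : R, 0 < s ->
    beta_star mu P (Phi_star mu P (beta_star mu P Phi)) s = beta_star mu P Phi s.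
Proof.
move=> s s0; set beta := beta_star mu P Phi.
have beta_ge0 t : (0 <= beta t)%E by rewrite le_max lexx orbT.
apply/eqP; rewrite eq_le; apply/andP; split.
  rewrite ge_max beta_ge0 andbT; apply: ge_ereal_sup => _ [f [f20 f_le1] <-].
  rewrite -eratio_le1//; apply: le_trans f_le1.
  (* The ratio at [s] is one term of [Phi_beta], which is the term [n = 0] of [Phi_star]. *)
  apply: (@le_trans _ _ (Phi_beta mu P beta f)).
    by apply: ereal_sup_ubound; exists s.
  by apply: ereal_sup_ubound; exists 0%N.
rewrite ge_max [X in _ && X]le_max lexx orbT andbT.
rewrite [leRHS]/beta_star le_max; apply/orP; left.
apply: le_ereal_sup => _ [f [f20 f_le1] <-]; exists f => //; split=> //.
(* Membership in [L20] is carried through the induction because [Phi_nonexp] only applies there. *)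
have iter_le1 n : L20 mu (iter n (kernel_op P) f) /\
    (Phi (iter n (kernel_op P) f) <= 1)%E.
  elim: n => [//|n [fn20 fn_le1]]; split; first exact: kernel_op_L20.
  by rewrite iterS (le_trans (Phi_nonexp _ _)).
apply: ge_ereal_sup => _ [n _ <-]; apply: ge_ereal_sup => _ [t t0 <-].
rewrite eratio_le1// le_max; apply/orP; left.
by apply: ereal_sup_ubound; exists (iter n (kernel_op P) f).
Qed.
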